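(* Let $q$ be a prime power, $1\le l\le k$ and $t\ge1$ integers, and let $f:\mathbb{F}_q^k\to\mathbb{F}_q^l$, $f(\mathbf{u})=\mathbf{F}\mathbf{u}$, be a linear function with $\mathbf{F}\in\mathbb{F}_q^{l\times k}$ of rank $l$ having exactly $l$ distinct non-zero columns. Let $J=\{j_1<\dots<j_l\}\subseteq\{1,\dots,k\}$ be such that the columns of $\mathbf{F}$ indexed by $J$ are the $l$ distinct non-zero columns of $\mathbf{F}$. Let $\mathbf{u}_0,\dots,\mathbf{u}_{q^l-1}$ be an enumeration of the subspace $\mathcal{S}=\{\mathbf{x}\in\mathbb{F}_q^k: x_j=0\text{ for all } j\notin J\}$, and let $\mathbf{u}'_i\in\mathbb{F}_q^l$ be the restriction of $\mathbf{u}_i$ to the coordinates in $J$. Put $f_i=f(\mathbf{u}_i)$. Then: (1) the optimal redundancy is $$ r_f(k,t)=N_q(\mathbf{D}_f(t,f_0,\dots,f_{q^l-1}))=N_q(\mathbf{D}_f(t,\mathbf{u}_0,\dots,\mathbf{u}_{q^l-1})).$$ (2) if $\{(\mathbf{w},\mathbf{p}(\mathbf{w})):\mathbf{w}\in\mathbb{F}_q^l\}$ is a systematic $(n,q^l,2t+1)_q$ code, then its parity vectors $\mathbf{p}(\mathbf{u}'_0),\dots,\mathbf{p}(\mathbf{u}'_{q^l-1})$ form (in this order) a $\mathbf{D}$-code for $\mathbf{D}=\mathbf{D}_f(t,\mathbf{u}_0,\dots,\mathbf{u}_{q^l-1})$.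
   Context: $d_H$ is Hamming distance and $[x]^+=\max(x,0)$. An $(f,t)$-FCC of redundancy $r$ is a systematic encoding $\mathfrak{E}:\mathbb{F}_q^k\to\mathbb{F}_q^{k+r}$, $\mathfrak{E}(\mathbf{u})=(\mathbf{u},\mathbf{p}(\mathbf{u}))$, such that $d_H(\mathfrak{E}(\mathbf{u}),\mathfrak{E}(\mathbf{u}'))\ge 2t+1$ whenever $f(\mathbf{u})\ne f(\mathbf{u}')$; $r_f(k,t)$ is the smallest $r$ for which one exists. For vectors $\mathbf{u}_0,\dots,\mathbf{u}_{M-1}\in\mathbb{F}_q^k$, $\mathbf{D}_f(t,\mathbf{u}_0,\dots,\mathbf{u}_{M-1})$ is the $M\times M$ matrix with $(i,j)$ entry $[2t+1-d_H(\mathbf{u}_i,\mathbf{u}_j)]^+$ if $f(\mathbf{u}_i)\ne f(\mathbf{u}_j)$ and $0$ otherwise. For $f_i,f_j\in\mathrm{Im}(f)$, $d_f(f_i,f_j)=\min\{d_H(\mathbf{u},\mathbf{u}'): f(\mathbf{u})=f_i,\ f(\mathbf{u}')=f_j\}$, and the function distance matrix $\mathbf{D}_f(t,f_0,\dots,f_{q^l-1})$ has $(i,j)$ entry $[2t+1-d_f(f_i,f_j)]^+$ if $i\ne j$ and $0$ if $i=j$. For a matrix $\mathbf{D}\in\mathbb{N}_0^{M\times M}$, a $\mathbf{D}$-code of length $r$ over $\mathbb{F}_q$ is a family $\mathbf{p}_1,\dots,\mathbf{p}_M\in\mathbb{F}_q^r$ (repetitions allowed) with $d_H(\mathbf{p}_i,\mathbf{p}_j)\ge[\mathbf{D}]_{ij}$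 for all $i,j$; $N_q(\mathbf{D})$ is the smallest $r$ for which a $\mathbf{D}$-code of length $r$ over $\mathbb{F}_q$ exists. A systematic $(n,q^l,d)_q$ code is a code $\{(\mathbf{w},\mathbf{p}(\mathbf{w})):\mathbf{w}\in\mathbb{F}_q^l\}\subseteq\mathbb{F}_q^n$ with $\mathbf{p}:\mathbb{F}_q^l\to\mathbb{F}_q^{n-l}$ and minimum Hamming distance $d$. *)

(* Defs.v *)
(* F_q is K : finFieldType with q = #|K|; vectors are columns. *)
From HB Require Import structures.
From mathcomp Require Export all_boot all_order all_algebra.

Set Implicit Arguments.
Unset Strict Implicit.
Unset Printing Implicit Defensive.

Import GRing.Theory.

Local Open Scope ring_scope.

Definition hdist (K : finFieldType) (n : nat) (x y : 'cV[K]_n) : nat :=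
  #|[set i : 'I_n | x i 0 != y i 0]|.

Definition is_least (P : nat -> Prop) (r : nat) : Prop :=
  P r /\ forall r' : nat, P r' -> (r <= r')%N.

Definition systematic (K : finFieldType) (k r : nat)
    (E : 'cV[K]_k -> 'cV[K]_(k + r)) : Prop :=
  exists p : 'cV[K]_k -> 'cV[K]_r, forall u, E u = col_mx u (p u).

Definition is_FCC (K : finFieldType) (k : nat) (T : eqType)
    (f : 'cV[K]_k -> T) (t r : nat) (E : 'cV[K]_k -> 'cV[K]_(k + r)) : Prop :=
  systematic E /\
  forall u u' : 'cV[K]_k, f u <> f u' -> (2 * t + 1 <= hdist (E u) (E u'))%N.

(* r = r_f(k, t) *)
Definition optimal_redundancy (K : finFieldType) (k : nat) (T : eqType)
    (f : 'cV[K]_k -> T) (t r : nat) : Prop :=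
  is_least (fun s => exists E : 'cV[K]_k -> 'cV[K]_(k + s), is_FCC f t E) r.

(* Truncated subtraction on nat plays the role of the positive part. *)
Definition vector_dist_mx (K : finFieldType) (k : nat) (T : eqType)
    (f : 'cV[K]_k -> T) (t M : nat) (u : 'I_M -> 'cV[K]_k) : 'M[nat]_M :=
  \matrix_(i, j) (if f (u i) != f (u j)
                  then (2 * t + 1 - hdist (u i) (u j))%N else 0%N).

(* Hamming distances in K^k are at most k, so the default value k of the
   iterated minimum is harmless as soon as a and b are both in the image
   of f. *)
Definition fun_dist (K : finFieldType) (k : nat) (T : eqType)
    (f : 'cV[K]_k -> T) (a b : T) : nat :=
  \big[minn/k]_(u | f u == a) \big[minn/k]_(u' | f u' == b) hdist u u'.

Definition fun_dist_mx (K : finFieldType) (k : nat) (T : eqType)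
    (f : 'cV[K]_k -> T) (t M : nat) (a : 'I_M -> T) : 'M[nat]_M :=
  \matrix_(i, j) (if i != j
                  then (2 * t + 1 - fun_dist f (a i) (a j))%N else 0%N).

Definition is_Dcode (K : finFieldType) (M r : nat) (D : 'M[nat]_M)
    (p : 'I_M -> 'cV[K]_r) : Prop :=
  forall i j : 'I_M, (D i j <= hdist (p i) (p j))%N.

(* r = N_q(D); a relation because some D (e.g. with a nonzero diagonal
   entry) admit no D-code of any length. *)
Definition optimal_length (K : finFieldType) (M : nat) (D : 'M[nat]_M)
    (r : nat) : Prop :=
  is_least (fun s => exists p : 'I_M -> 'cV[K]_s, is_Dcode D p) r.

(* As for fun_dist, the default value n only matters when C has fewer than
   two codewords. *)
Definition min_dist (K : finFieldType) (n : nat) (C : {set 'cV[K]_n}) : nat :=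
  \big[minn/n]_(c in C) \big[minn/n]_(c' in C | c' != c) hdist c c'.

(* C is an (n, M, d)_q code *)
Definition is_code (K : finFieldType) (n : nat) (M d : nat)
    (C : {set 'cV[K]_n}) : Prop :=
  #|C| = M /\ min_dist C = d.

Definition systematic_code (K : finFieldType) (l r : nat)
    (p : 'cV[K]_l -> 'cV[K]_r) : {set 'cV[K]_(l + r)} :=
  [set col_mx w (p w) | w : 'cV[K]_l].

Definition nonzero_columns (K : finFieldType) (l k : nat)
    (F : 'M[K]_(l, k)) : {set 'cV[K]_l} :=
  [set col x F | x : 'I_k & col x F != 0].

Definition coord_subspace (K : finFieldType) (k : nat) (J : {set 'I_k}) :
    {set 'cV[K]_k} :=
  [set x : 'cV[K]_k | [forall j : 'I_k, (j \notin J) ==> (x j 0 == 0)]].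

(* Main.v *)
Require Import Defs.
From mathcomp Require Import all_boot all_order all_algebra.

Set Implicit Arguments.
Unset Strict Implicit.
Unset Printing Implicit Defensive.

Import GRing.Theory.

Local Open Scope ring_scope.

(** Every column of [F] is zero or one of the [l] columns [F_J], so [F = G B]
with [G] the invertible submatrix on [J] and [B] a 0/1 matrix having at most one
nonzero entry per column.  Such a [B] does not increase Hamming distances, and
neither does the embedding of [K^l] onto the coordinate subspace [S].  Hence
[x |-> B x] retracts [K^k] onto [S] along the fibres of [f] without increasing
distances: the enumeration of [S] realises all function distances, and a D-code
indexed by [S] pulls back to parities on all of [K^k]. *)

Section HammingDistance.

Variable K : finFieldType.

Lemma hdist_le_dim n (x y : 'cV[K]_n) : (hdist x y <= n)%N.
Proof. by rewrite -[leqRHS]card_ord max_card. Qed.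

Lemma hdistxx n (x : 'cV[K]_n) : hdist x x = 0%N.
Proof. by apply: eq_card0 => i; rewrite !inE eqxx. Qed.

Lemma hdist_gt0 n (x y : 'cV[K]_n) : (0 < hdist x y)%N = (x != y).
Proof.
have [->|nxy] := eqVneq x y; first by rewrite hdistxx.
rewrite card_gt0; apply: contraNneq nxy => D0; apply/eqP/matrixP=> i k.
by apply/eqP/negPn/negP => nik; have := in_set0 i; rewrite -D0 inE -(ord1 k) nik.
Qed.

Lemma hdist_col_mx m n (x x' : 'cV[K]_m) (y y' : 'cV[K]_n) :
  hdist (col_mx x y) (col_mx x' y') = (hdist x x' + hdist y y')%N.
Proof.
rewrite /hdist -!sum1dep_card big_split_ord /=.
by congr (_ + _)%N; apply: eq_bigl => i; rewrite ?col_mxEu ?col_mxEd.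
Qed.

(** If the images differ in row [a], then [x] and [y] differ at some column index [i] with
    [B a i != 0]. Since column [i] has no other nonzero entry, [a] is recovered from [i] by [g], so
    the differing rows lie in the image under [g] of the differing indices. The option type accounts
    for zero columns. *)
Lemma hdist_mulmx_le m n (B : 'M[K]_(m, n)) (x y : 'cV[K]_n) :
  (forall i a b, B a i != 0 -> B b i != 0 -> a = b) ->
  (hdist (B *m x) (B *m y) <= hdist x y)%N.
Proof.
move=> Bcol; pose g i := [pick a | B a i != 0].
rewrite /hdist -(card_imset _ (@Some_inj _)).
apply: leq_trans (leq_imset_card g _); apply/subset_leq_card/subsetP => z.
case/imsetP => a; rewrite inE => nBa ->; apply/imsetP.
have [i nxi Bai]: exists2 i, x i 0 != y i 0 & B a i != 0.
  apply/exists_inP; apply: contraNT nBa => /exists_inPn E.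
  rewrite !mxE; apply/eqP/eq_bigr => i _.
  by have [->//|/E/negPn/eqP ->] := eqVneq (x i 0) (y i 0); rewrite !mul0r.
exists i; rewrite ?inE // /g; case: pickP => [b Bbi|/(_ a)].
  by rewrite (Bcol _ _ _ Bai Bbi).
by rewrite Bai.
Qed.

(* Iterated concatenation of the given vectors is a repetition code. *)
Lemma separating_family_exists M n (u : 'I_M -> 'cV[K]_n) (d : nat) :
  injective u ->
  exists s (p : 'I_M -> 'cV[K]_s), forall i j, i != j -> (d <= hdist (p i) (p j))%N.
Proof.
move=> u_inj; elim: d => [|d [s [p ple]]]; first by exists n, u.
exists (n + s)%N, (fun i => col_mx (u i) (p i)) => i j ij.
by rewrite hdist_col_mx -add1n leq_add ?ple // hdist_gt0 (inj_eq u_inj).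
Qed.

End HammingDistance.

Section BigMin.

Variables (I : finType) (P : pred I) (m : nat) (F : I -> nat).

Lemma bigminn_le i : P i -> (\big[minn/m]_(i | P i) F i <= F i)%N.
Proof.
move=> Pi; rewrite -big_filter.
have: i \in [seq i <- index_enum I | P i] by rewrite mem_filter Pi mem_index_enum.
elim: [seq _ <- _ | _] => // a s IHs; rewrite inE big_cons geq_min.
by case/predU1P => [->|/IHs ->]; rewrite ?leqnn ?orbT.
Qed.

Lemma bigminn_ge d :
  (d <= m)%N -> (forall i, P i -> d <= F i)%N -> (d <= \big[minn/m]_(i | P i) F i)%N.
Proof.
by move=> dm dF; elim/big_ind: _ => // a b da db; rewrite leq_min da.
Qed.

End BigMin.

Lemma min_dist_le (K : finFieldType) n (C : {set 'cV[K]_n}) c c' :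
  c \in C -> c' \in C -> c' != c -> (min_dist C <= hdist c c')%N.
Proof.
move=> Cc Cc' nc; apply: leq_trans (bigminn_le _ _ Cc) _.
by apply: bigminn_le; rewrite Cc'.
Qed.

Lemma is_least_ext (P Q : nat -> Prop) r :
  (forall s, P s <-> Q s) -> is_least P r -> is_least Q r.
Proof. by move=> PQ [Pr Pmin]; split=> [|s /PQ]; [apply/PQ | apply: Pmin]. Qed.

Lemma optimal_length_exists (K : finFieldType) M (D : 'M[nat]_M) s
    (p : 'I_M -> 'cV[K]_s) :
  is_Dcode D p -> exists r, optimal_length K D r.
Proof.
(* Restricting to finite functions makes existence of a code of given length decidable, as [ex_minn]
   requires. *)
pose has_code s := [exists p : {ffun 'I_M -> 'cV[K]_s},
  [forall i, forall j, (D i j <= hdist (p i) (p j))%N]].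
have has_codeP s' : reflect (exists p : 'I_M -> 'cV[K]_s', is_Dcode D p) (has_code s').
  apply: (iffP existsP) => [[p' /forallP Dp]|[p' Dp]].
    by exists p' => i j; have /forallP := Dp i.
  by exists [ffun i => p' i]; apply/forallP=> i; apply/forallP=> j; rewrite !ffunE.
move=> Dp; have exs: exists s, has_code s by exists s; apply/has_codeP; exists p.
exists (ex_minn exs); case: ex_minnP => r /has_codeP rP rmin.
by split=> // r' /has_codeP /rmin.
Qed.

Section ContractingRepresentatives.

Variables (K : finFieldType) (k t M : nat) (T : eqType).
Variables (f : 'cV[K]_k -> T) (u : 'I_M -> 'cV[K]_k) (c : 'cV[K]_k -> 'I_M).
Hypothesis fu_inj : injective (f \o u).
Hypothesis f_repr : forall x, f (u (c x)) = f x.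
Hypothesis repr_le : forall x y, (hdist (u (c x)) (u (c y)) <= hdist x y)%N.

(** Any pair taken from the two fibres contracts to the pair [u i], [u j], which therefore attains
    the minimum. *)
Lemma fun_dist_repr i j : fun_dist f (f (u i)) (f (u j)) = hdist (u i) (u j).
Proof.
apply/eqP; rewrite eqn_leq; apply/andP; split.
  by apply: (leq_trans (bigminn_le _ _ (eqxx (f (u i))))); apply: bigminn_le.
have cK x i' : f x == f (u i') -> c x = i'.
  by move=> /eqP fx; apply: fu_inj; rewrite /= f_repr.
(* The lower bound must also hold for the default value [k] of both minima. *)
apply: bigminn_ge => [|x /cK <-]; first exact: hdist_le_dim.
by apply: bigminn_ge => [|y /cK <-]; rewrite ?hdist_le_dim.
Qed.

Lemma fun_dist_mx_repr :
  fun_dist_mx f t (fun i => f (u i)) = vector_dist_mx f t u.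
Proof.
apply/matrixP=> i j; rewrite !mxE fun_dist_repr.
by rewrite -(inj_eq fu_inj).
Qed.

(** A code on the representatives gives [x] the parity of [u (c x)]: contraction leaves at least as
    much distance between messages as between representatives, so the parities need no more than the
    matrix entry. Conversely, the parities of an FCC are restricted to the [u i]. *)
Lemma FCC_Dcode s :
  (exists p : 'I_M -> 'cV[K]_s, is_Dcode (vector_dist_mx f t u) p) <->
  (exists E : 'cV[K]_k -> 'cV[K]_(k + s), is_FCC f t E).
Proof.
split=> [[p Dp]|[E [[p Ep] Ed]]].
  exists (fun x => col_mx x (p (c x))); split=> [|x y nf]; first by exists (p \o c).
  rewrite hdist_col_mx -leq_subLR; apply: leq_trans (Dp _ _).
  by rewrite mxE !f_repr; case: eqP => // _; apply: leq_sub2l.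
exists (p \o u) => i j; rewrite mxE; case: eqP => // /Ed.
by rewrite !Ep hdist_col_mx leq_subLR.
Qed.

Lemma optimal_redundancy_repr :
  exists r : nat,
    [/\ optimal_redundancy f t r,
        optimal_length K (fun_dist_mx f t (fun i => f (u i))) r
      & optimal_length K (vector_dist_mx f t u) r].
Proof.
have u_inj : injective u by move=> i j ij; apply: fu_inj; rewrite /= ij.
(* No matrix entry exceeds [2 * t + 1], so this family is a code of some length, and a least length
   exists. *)
have [s [p ple]] := separating_family_exists (2 * t + 1) u_inj.
have Dp: is_Dcode (vector_dist_mx f t u) p.
  move=> i j; rewrite mxE; case: eqP => // nf.
  by apply: leq_trans (leq_subr _ _) (ple _ _ _); apply/eqP => ij; rewrite ij in nf.
have [r rmin] := optimal_length_exists Dp.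
exists r; rewrite fun_dist_mx_repr; split=> //.
exact: is_least_ext FCC_Dcode rmin.
Qed.

End ContractingRepresentatives.

Section ColumnFactorization.

Variables (K : finFieldType) (k l : nat) (F : 'M[K]_(l, k)) (j : 'I_l -> 'I_k).
Hypothesis rankF : \rank F = l.
Hypothesis colj_inj : injective (fun a => col (j a) F).
Hypothesis colj_neq0 : forall a, col (j a) F != 0.
Hypothesis colj_onto : forall x, col x F != 0 -> exists a, col x F = col (j a) F.

Definition column_class : 'M[K]_(l, k) :=
  \matrix_(a, x) (col x F == col (j a) F)%:R.

Lemma column_class_unique x a b :
  column_class a x != 0 -> column_class b x != 0 -> a = b.
Proof.
rewrite !mxE; case: (_ =P col (j a) F) => [-> _|_]; last by rewrite eqxx.
by case: (_ =P col (j b) F) => [/colj_inj //|_]; rewrite eqxx.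
Qed.

Lemma column_classE a b : column_class a (j b) = (a == b)%:R.
Proof. by rewrite mxE (inj_eq colj_inj) eq_sym. Qed.

Lemma column_factorization : F = colsub j F *m column_class.
Proof.
apply/matrixP => i x; rewrite mxE.
have [Fx0|/colj_onto [b Fxb]] := eqVneq (col x F) 0.
  have -> : F i x = 0 by have /matrixP/(_ i 0) := Fx0; rewrite !mxE.
  by rewrite big1 // => a _; rewrite !mxE Fx0 eq_sym (negPf (colj_neq0 a)) mulr0.
have -> : F i x = F i (j b) by have /matrixP/(_ i 0) := Fxb; rewrite !mxE.
rewrite (bigD1 b) //= !mxE Fxb eqxx mulr1 big1 ?addr0 // => a nab.
by rewrite !mxE Fxb (inj_eq colj_inj) eq_sym (negPf nab) mulr0.
Qed.

(** By the factorization, the rank [l] of [F] is at most that of this square factor. *)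
Lemma colsub_unitmx : colsub j F \in unitmx.
Proof.
rewrite -row_full_unit /row_full eqn_leq rank_leq_col /=.
by rewrite -{1}rankF {1}column_factorization mxrankM_maxl.
Qed.

End ColumnFactorization.

Theorem mainTheorem13 (K : finFieldType) (k l t : nat)
  (l_ge1 : (1 <= l)%N) (l_le_k : (l <= k)%N) (t_ge1 : (1 <= t)%N)
  (F : 'M[K]_(l, k)) (f : 'cV[K]_k -> 'cV[K]_l)
  (fE : forall u : 'cV[K]_k, f u = F *m u)
  (rankF : \rank F = l)
  (card_cols : #|nonzero_columns F| = l)
  (* J = {j 0 < ... < j (l-1)} *)
  (j : 'I_l -> 'I_k) (J : {set 'I_k})
  (j_incr : forall a b : 'I_l, (a < b)%N -> (j a < j b)%N)
  (JE : J = [set j a | a : 'I_l])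
  (J_cols : [set col x F | x in J] = nonzero_columns F)
  (* u enumerates the subspace S *)
  (u : 'I_(#|K| ^ l) -> 'cV[K]_k)
  (u_inj : injective u)
  (u_im : [set u i | i : 'I_(#|K| ^ l)] = coord_subspace K J)
  (u' : 'I_(#|K| ^ l) -> 'cV[K]_l)
  (u'E : forall i : 'I_(#|K| ^ l), u' i = \col_(a < l) u i (j a) 0) :
  (exists r : nat,
    [/\ optimal_redundancy f t r,
        optimal_length K (fun_dist_mx f t (fun i => f (u i))) r
      & optimal_length K (vector_dist_mx f t u) r])
  /\
  (* here n = l + r *)
  (forall (r : nat) (p : 'cV[K]_l -> 'cV[K]_r),
    is_code (#|K| ^ l) (2 * t + 1) (systematic_code p) ->
    is_Dcode (vector_dist_mx f t u) (fun i => p (u' i))).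
Proof.
have j_inj : injective j.
  by move=> a b jab; apply/val_inj; case: (ltngtP a b) => // /j_incr;
    rewrite jab ltnn.
have colj_inj : injective (fun a => col (j a) F).
  (* [J] has [l] elements and yields [l] distinct columns, so no two indices in [J] share a
     column. *)
  have /imset_injP colJ: #|[set col x F | x in J]| == #|J|.
    by rewrite J_cols card_cols JE card_imset // card_ord.
  by move=> a b /colJ jab; apply/j_inj/jab; rewrite JE imset_f.
have J_col x : (col x F != 0) = (col x F \in [set col y F | y in J]).
  rewrite J_cols; apply/idP/imsetP => [nx|[y]]; first by exists x; rewrite ?inE.
  by rewrite inE => ny ->.
have colj_neq0 a : col (j a) F != 0.
  by rewrite J_col; apply: imset_f; rewrite JE imset_f.
have colj_onto x : col x F != 0 -> exists a, col x F = col (j a) F.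
  rewrite J_col => /imsetP[_ /[!JE] /imsetP[a _ ->] ->]; by exists a.
pose B := column_class F j.
(* Cancelling the invertible factor, [f] and [B] have the same fibres. *)
have fB x y : (f x == f y) = (B *m x == B *m y).
  rewrite !fE (column_factorization colj_inj colj_neq0 colj_onto) -!mulmxA.
  exact/inj_eq/can_inj/mulKmx/colsub_unitmx.
have B_le x y : (hdist (B *m x) (B *m y) <= hdist x y)%N.
  exact/hdist_mulmx_le/column_class_unique.
have u0 i x : x \notin J -> u i x 0 = 0.
  move=> nx; have: u i \in coord_subspace K J by rewrite -u_im imset_f.
  by rewrite inE => /forallP/(_ x); rewrite nx => /eqP.
(* [R] spreads a vector over the coordinates in [J] and puts zeros elsewhere; it inverts the
   restriction [u'] on the subspace. *)
pose R : 'M[K]_(k, l) := \matrix_(x, a) (x == j a)%:R.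
have uR i : u i = R *m u' i.
  apply/matrixP => x b; rewrite (ord1 b) mxE u'E.
  have [|nx] := boolP (x \in J); last first.
    rewrite u0 // big1 // => a _; rewrite !mxE; case: eqP => [xa|_]; last exact: mul0r.
    by rewrite xa JE imset_f in nx.
  rewrite JE => /imsetP[a _ ->]; rewrite (bigD1 a) //= !mxE eqxx mul1r.
  by rewrite big1 ?addr0 // => c ca; rewrite !mxE (inj_eq j_inj) eq_sym (negPf ca) mul0r.
have BR : B *m R = 1%:M.
  apply/matrixP => a b; rewrite !mxE (bigD1 (j b)) //= big1 => [|x nx].
    by rewrite column_classE // !mxE eqxx mulr1 addr0.
  by rewrite !mxE (negPf nx) mulr0.
have Bu i : B *m u i = u' i by rewrite uR mulmxA BR mul1mx.
have R_le x y : (hdist (R *m x) (R *m y) <= hdist x y)%N.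
  apply: hdist_mulmx_le => a x' y'; rewrite !mxE.
  case: (x' =P _) => [-> _|_]; last by rewrite eqxx.
  by case: (y' =P _) => [->//|_]; rewrite eqxx.
have u'_inj : injective u' by move=> i i' uu; apply: u_inj; rewrite !uR uu.
have [e _ eK] : bijective u'.
  by apply: inj_card_bij => //; rewrite card_mx muln1 card_ord.
split.
  (* With [e] the inverse of [u'], the representative of [x] is [R *m (B *m x)], a composite of two
     contractions. *)
  apply: (@optimal_redundancy_repr _ _ t _ _ f u (fun x => e (B *m x))).
  - by move=> i i' /eqP /=; rewrite fB !Bu => /eqP/u'_inj.
  - by move=> x; apply/eqP; rewrite fB Bu eK.
  - by move=> x y; rewrite !uR !eK; apply: leq_trans (R_le _ _) (B_le _ _).
move=> r p [_ min_p] i i'; rewrite mxE fB !Bu; case: eqP => // /eqP nu.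
rewrite leq_subLR -min_p.
have C_in w : col_mx w (p w) \in systematic_code p by apply: imset_f.
apply: leq_trans (min_dist_le (C_in (u' i)) (C_in (u' i')) _) _.
  by apply: contraNneq nu => /eq_col_mx[->].
(* The message parts [u' i] are the images [B *m u i], hence no farther apart than the [u i]. *)
by rewrite hdist_col_mx leq_add2r -!Bu.
Qed.
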